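(* Let $\Gamma$ be a finitely generated group and let $(\Gamma,\Lambda)$ be a Hecke pair with engulfing triple $(E,\rho,\Delta)$. Then there exist a locally compact group $G$ and a virtual uniform lattice embedding $\gamma:\Gamma\to G$ such that $G$ fits into a short exact sequence $1\to E\xrightarrow{p}G\xrightarrow{q}Q\to1$ and: (1) $(Q,\lambda)$ is the Schlichting completion of $(\Gamma,\Lambda_0)$ for some finite index subgroup $\Lambda_0\le\Lambda$; (2) $p$ is a topological embedding and $q$ is a topological quotient map; (3) $\lambda=q\circ\gamma$; (4) for all $g\in\Gamma$ and $v\in E$, $p(\Delta(g)(v))=\gamma(g)p(v)\gamma(g)^{-1}$.
   Context: A Hecke pair $(\Gamma,\Lambda)$ is a group $\Gamma$ with a commensurated subgroup $\Lambda$ (i.e. $g\Lambda g^{-1}\cap\Lambda$ has finite index in both for all $g$). A homomorphism from a discrete group to a locally compact group is a virtual uniform lattice embedding if it has finite kernel and its image is a uniform (discrete cocompact) lattice. An engulfing triple $(E,\rho,\Delta)$ of $(\Gamma,\Lambda)$ consists of a locally compact group $E$, a virtual uniform lattice embedding $\rho:\Lambda\to E$ and a homomorphism $\Delta:\Gamma\to\mathrm{Aut}(E)$ such that (i) $\Delta|_\Lambda$ equals $h\mapsto(e\mapsto\rho(h)e\rho(h)^{-1})$, and (ii) for every $g\in\Gamma$ there is a finite index subgroup $\Lambda_g\le\Lambda$ with $\Delta(g)(\rho(h))=\rho(ghg^{-1})$ for all $h\in\Lambda_g$. The Schlichting completion of a Hecke pair $(\Gamma,\Lambda)$ is $(Q,\lambda)$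 where $Q$ is the closure of the image of the left-multiplication action $\Gamma\to\mathrm{Sym}(\Gamma/\Lambda)$ in the topology of pointwise convergence, and $\lambda:\Gamma\to Q$ is the induced map. *)

(* Defs.v *)
From HB Require Import structures.
From mathcomp Require Import all_boot.
From mathcomp Require Import monoid.
From mathcomp Require Import all_classical topology.

Set Implicit Arguments.
Unset Strict Implicit.
Unset Printing Implicit Defensive.

Local Open Scope classical_set_scope.
Local Open Scope group_scope.

HB.mixin Record Group_Topological_isTopGroup G of Group G & Topological G := {
  mulg_continuous : continuous (fun xy : G * G => xy.1 * xy.2);
  invg_continuous : continuous (fun x : G => x^-1)
}.

#[short(type="topGroupType")]
HB.structure Definition TopGroup :=
  {G of Group_Topological_isTopGroup G & Group G & Topological G}.

Definition locally_compact_group (G : topGroupType) : Prop :=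
  hausdorff_space G /\ locally_compact [set: G].

Definition is_subgroup (G : groupType) (H : set G) : Prop :=
  H 1 /\ (forall x y, H x -> H y -> H (x * y)) /\ (forall x, H x -> H x^-1).

Definition finite_index (G : groupType) (H K : set G) : Prop :=
  H `<=` K /\
  exists s : seq G, (forall x, x \in s -> K x) /\
    forall k, K k -> exists2 x, x \in s & H (x^-1 * k).

Definition conj_set (G : groupType) (g : G) (H : set G) : set G :=
  [set g * h * g^-1 | h in H].

Definition hecke_pair (G : groupType) (L : set G) : Prop :=
  is_subgroup L /\
  forall g : G, finite_index (conj_set g L `&` L) L /\
                finite_index (conj_set g L `&` L) (conj_set g L).

Definition finitely_generated (G : groupType) : Prop :=
  exists s : seq G, forall H : set G, is_subgroup H ->
    (forall x, x \in s -> H x) -> H = [set: G].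

Definition hom_on (G H : groupType) (D : set G) (f : G -> H) : Prop :=
  forall x y, D x -> D y -> f (x * y) = f x * f y.

Definition hom (G H : groupType) (f : G -> H) : Prop := hom_on [set: G] f.

Definition discrete_subset (T : topologicalType) (S : set T) : Prop :=
  forall s, S s -> exists U : set T, [/\ open U, U s & U `&` S = [set s]].

Definition uniform_lattice (G : topGroupType) (S : set G) : Prop :=
  is_subgroup S /\ discrete_subset S /\
  exists K : set G, compact K /\ forall x : G, exists k s, K k /\ S s /\ x = k * s.

Definition virtual_uniform_lattice_embedding_on (G : groupType) (H : topGroupType)
    (D : set G) (rho : G -> H) : Prop :=
  hom_on D rho /\
  finite_set [set x | D x /\ rho x = 1] /\
  uniform_lattice (rho @` D).

Definition virtual_uniform_lattice_embedding (G : groupType) (H : topGroupType)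
    (rho : G -> H) : Prop :=
  virtual_uniform_lattice_embedding_on [set: G] rho.

Definition top_group_aut (E : topGroupType) (a : E -> E) : Prop :=
  hom a /\ continuous a /\
  exists b : E -> E, cancel a b /\ cancel b a /\ continuous b.

Definition engulfing_triple (Gam : groupType) (Lam : set Gam) (E : topGroupType)
    (rho : Gam -> E) (Delta : Gam -> E -> E) : Prop :=
  [/\ locally_compact_group E,
      virtual_uniform_lattice_embedding_on Lam rho,
      (forall g, top_group_aut (Delta g)) /\
        (forall g h v, Delta (g * h) v = Delta g (Delta h v)),
      (forall h, Lam h -> forall e, Delta h e = rho h * e * (rho h)^-1)
    &
      (forall g, exists Lg : set Gam, is_subgroup Lg /\ finite_index Lg Lam /\
         (forall h, Lg h -> Lam (g * h * g^-1)) /\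
         forall h, Lg h -> Delta g (rho h) = rho (g * h * g^-1))].

Definition lcoset (G : groupType) (x : G) (L0 : set G) : set G :=
  [set x * h | h in L0].

Definition is_lcoset (G : groupType) (L0 : set G) (C : set G) : Prop :=
  exists x, C = lcoset x L0.

Definition lmul_set (G : groupType) (g : G) (C : set G) : set G :=
  [set g * c | c in C].

(* (Q, lam) is (isomorphic, as a pair, to) the Schlichting completion of
   (Gamma, L0): there is phi : Q -> Sym(Gamma/L0) such that
   - phi is an injective group homomorphism into the group of permutations
     of the coset space Gamma/L0;
   - phi (lam g) is the left multiplication by g on Gamma/L0;
   - the image of phi is exactly the closure, in the topology of pointwise
     convergence, of the image of Gamma, i.e. the permutations which agree
     on every finite set of cosets with the action of some g;
   - phi is a homeomorphism onto its image: the topology of Q is the one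
     pulled back from the topology of pointwise convergence. *)
Definition schlichting_completion (Gam : groupType) (L0 : set Gam)
    (Q : topGroupType) (lam : Gam -> Q) : Prop :=
  exists phi : Q -> set Gam -> set Gam,
  [/\
      (forall q C, is_lcoset L0 C -> is_lcoset L0 (phi q C)) /\
      (forall q C, is_lcoset L0 C -> exists2 D, is_lcoset L0 D & phi q D = C) /\
      (forall q C D, is_lcoset L0 C -> is_lcoset L0 D -> phi q C = phi q D -> C = D),
      (forall q1 q2 C, is_lcoset L0 C -> phi (q1 * q2) C = phi q1 (phi q2 C)) /\
      (forall q1 q2, (forall C, is_lcoset L0 C -> phi q1 C = phi q2 C) -> q1 = q2),
      (forall g C, is_lcoset L0 C -> phi (lam g) C = lmul_set g C),
      (forall sigma : set Gam -> set Gam,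
         ((forall C, is_lcoset L0 C -> is_lcoset L0 (sigma C)) /\
          (forall C, is_lcoset L0 C -> exists2 D, is_lcoset L0 D & sigma D = C) /\
          (forall C D, is_lcoset L0 C -> is_lcoset L0 D -> sigma C = sigma D -> C = D) /\
          (forall s : seq Gam, exists g : Gam,
             forall x, x \in s -> sigma (lcoset x L0) = lmul_set g (lcoset x L0)))
         <-> exists q, forall C, is_lcoset L0 C -> phi q C = sigma C)
    &
      (forall (q : Q) (A : set Q), nbhs q A <->
         exists s : seq Gam,
           [set q' | forall x, x \in s ->
                     phi q' (lcoset x L0) = phi q (lcoset x L0)] `<=` A)].

Definition topological_embedding (S T : topologicalType) (f : S -> T) : Prop :=
  injective f /\ continuous f /\
  forall U : set S, open U -> exists V : set T, open V /\ U = f @^-1` V.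

Definition topological_quotient_map (S T : topologicalType) (f : S -> T) : Prop :=
  (forall y, exists x, f x = y) /\
  forall V : set T, open V <-> open (f @^-1` V).

(* Main.v *)
(** Twist the lattice inside the semidirect product: with [A = E x| Gam] and a
    finite index subgroup [L] of [Lam], the elements [(rho h)^-1 h] for [h] in
    [L] form a subgroup [N] of [A] which commutes with [E].  The group [G] is
    the completion of [A] with respect to the conjugates of [N], that is, the
    closure of [A] in the permutations of [A / N], with the topology whose
    neighbourhoods of [1] are a neighbourhood of [1] in [E] times the stabilizer
    of finitely many points of [A / N].  Stabilizers are compact because [N] is
    commensurated, and [G] is locally [E] times such a stabilizer.

    The map [A -> Gam] extends to [q : G -> Q].  It is open with kernel exactly
    [E] provided that an [h] in [L] which fixes enough cosets of [L] satisfies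
    [Delta g (rho h) = rho (g h g^-1)].  This need not hold for [Lam] itself, but
    it holds for [L] as soon as the relation holds on [L] for each [g] in a
    finite generating set: it then propagates along words.  *)

Require Import Defs.
From HB Require Import structures.
From mathcomp Require Import all_boot.
From mathcomp Require Import monoid.
From mathcomp Require Import all_classical topology.

Set Implicit Arguments.
Unset Strict Implicit.
Unset Printing Implicit Defensive.

Local Open Scope classical_set_scope.
Local Open Scope group_scope.

(** * The completion of a group along a subgroup *)

Ltac group :=
  rewrite ?(invgM, invgK, invg1, mulgA, mul1g, mulg1, mulgV, mulVg, mulgK, mulgVK);
  try done.

(* [dnear] is meant to be the trace on the whole group of the neighbourhoods of
   [1] in a topological subgroup commuting with [dsub]. *)
Record completion_data := CompletionData {
  dgroup :> groupType;
  dsub : set dgroup;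
  dnear : set_system dgroup;
  dsub_subgroup : is_subgroup dsub;
  dnear_filter : Filter dnear;
  dnear_one : forall U, dnear U -> U 1;
  dnear_mul : forall U, dnear U ->
    exists2 V, dnear V & forall u v, V u -> V v -> U (u * v);
  dnear_inv : forall U, dnear U -> dnear [set u | U u^-1];
  dnear_conj : forall a U, dnear U -> dnear [set u | U (a * u * a^-1)];
  dnear_central : dnear [set u | forall n, dsub n -> u * n = n * u]
}.

Arguments dsub {_} _.
Arguments dnear {_} _.

#[global] Existing Instance dnear_filter.

Section Coset.
Context {D : completion_data}.
Implicit Types x y z a n : D.

Definition ceq x y : Prop := dsub (x^-1 * y).

Lemma dsub1 : dsub (1 : D). Proof. by case: (dsub_subgroup D). Qed.

Lemma dsubM x y : dsub x -> dsub y -> dsub (x * y).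
Proof. by case: (dsub_subgroup D) => _ [+ _]; exact. Qed.

Lemma dsubV x : dsub x -> dsub x^-1.
Proof. by case: (dsub_subgroup D) => _ [_]; exact. Qed.

Lemma ceqxx x : ceq x x. Proof. by rewrite /ceq mulVg; exact: dsub1. Qed.

Lemma ceq_sym x y : ceq x y -> ceq y x.
Proof. by move=> /dsubV; rewrite /ceq; group. Qed.

Lemma ceq_trans y x z : ceq x y -> ceq y z -> ceq x z.
Proof. by move=> xy yz; have := dsubM xy yz; rewrite /ceq; group. Qed.

Lemma ceq_mull a x y : ceq (a * x) (a * y) <-> ceq x y.
Proof. by rewrite /ceq; group. Qed.

Lemma ceq_mulVl a x y : ceq (a^-1 * x) y <-> ceq x (a * y).
Proof. by rewrite /ceq; group. Qed.

Lemma ceq_mulr x n : dsub n -> ceq x (x * n).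
Proof. by rewrite /ceq; group. Qed.

End Coset.

(** Membership in the pointwise closure of the left translations, [R x] being read as a left coset.
    This forces totality, compatibility with cosets and injectivity; surjectivity is added in
    [completion]. *)
Definition rel_approx (D : completion_data) (R : D -> D -> Prop) :=
  forall s : seq D, exists a, forall x, x \in s -> forall y, R x y <-> ceq (a * x) y.

(* The relation [crel] encodes a permutation of the coset space [D / dsub]:
   [crel x y] means that it sends the coset of [x] to the coset of [y]. *)
Record completion (D : completion_data) := Completion {
  crel :> D -> D -> Prop;
  crelP : rel_approx crel /\ forall y, exists x, crel x y
}.

(** * The group of permutations of the coset space approximated by left translations *)

Section Relations.
Context {D : completion_data}.
Implicit Types (x y z a n u : D) (R S T : completion D).

Lemma completion_eq R S : (forall x y, R x y <-> S x y) -> R = S.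
Proof.
case: R S => [r rP] [s sP] /= rs.
have e : r = s by apply/funext => x; apply/funext => y; apply/propext.
by case: s / e sP {rs} => sP; congr Completion; exact: Prop_irrelevance.
Qed.

Lemma crel_approx R : rel_approx R. Proof. by case: (crelP R). Qed.

Lemma crel_exl R y : exists x, R x y. Proof. by case: (crelP R). Qed.

Lemma crel_exr R x : exists y, R x y.
Proof.
have [a /(_ x)] := crel_approx R [:: x]; rewrite inE eqxx => aE.
by exists (a * x); apply/aE => //; exact: ceqxx.
Qed.

Lemma crel_approx2 R x y : exists a,
  (forall z, R x z <-> ceq (a * x) z) /\ (forall z, R y z <-> ceq (a * y) z).
Proof.
by have [a aE] := crel_approx R [:: x; y]; exists a; split;
  apply: aE; rewrite !inE eqxx ?orbT.
Qed.

Lemma crel_cosetr R x y z : R x y -> (R x z <-> ceq y z).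
Proof.
have [a [aE _]] := crel_approx2 R x x; move=> /aE xy; split=> [/aE xz|yz].
  exact: ceq_trans (ceq_sym xy) xz.
by apply/aE; exact: ceq_trans yz.
Qed.

Lemma crel_cosetl R x y z : R x y -> (R z y <-> ceq x z).
Proof.
have [a [aE bE]] := crel_approx2 R x z; move=> /aE xy.
split=> [/bE zy|/ceq_mull xz]; first by apply/ceq_mull; exact: ceq_trans xy (ceq_sym zy).
by apply/bE; exact: ceq_trans (ceq_sym (xz a)) xy.
Qed.

(** Surjectivity provides a preimage [f y] of each [y], and [R] is approximated on these
    preimages. *)
Lemma crel_approx_sym R (s : seq D) :
  exists a, forall y, y \in s -> forall x, R x y <-> ceq (a * x) y.
Proof.
have [f fP] := choice (crel_exl R).
have [a aE] := crel_approx R (map f s); exists a => y ys x.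
have /aE afy : f y \in map f s by exact: map_f.
have /afy ay := fP y.
split=> [/(crel_cosetl _ (fP y)) yx|xy].
  by apply: ceq_trans ay; apply/ceq_mull/ceq_sym.
apply/(crel_cosetl _ (fP y))/(ceq_mull a).
exact: ceq_trans ay (ceq_sym xy).
Qed.

Lemma cone_subproof : rel_approx (@ceq D) /\ forall y : D, exists x, ceq x y.
Proof.
split=> [s|y]; last by exists y; exact: ceqxx.
by exists 1 => x _ y; rewrite mul1g.
Qed.

Definition cone := Completion cone_subproof.

Lemma cmul_subproof R S : rel_approx (fun x z => exists y, S x y /\ R y z) /\
  forall z, exists x y, S x y /\ R y z.
Proof.
split=> [s|z]; last first.
  by have [y yz] := crel_exl R z; have [x xy] := crel_exl S y; exists x, y.
have [b bE] := crel_approx S s.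
have [a aE] := crel_approx R (map (mul b) s); exists (a * b) => x xs z.
have /aE abx : b * x \in map (mul b) s by exact: map_f.
have Sx : S x (b * x) by apply/bE => //; exact: ceqxx.
rewrite -mulgA -abx; split=> [[y [/(crel_cosetr _ Sx) xy yz]]|]; last by exists (b * x).
by apply/(crel_cosetl _ yz)/ceq_sym.
Qed.

Definition cmul R S := Completion (cmul_subproof R S).

Lemma cinv_subproof R : rel_approx (fun x y => R y x) /\
  forall y, exists x, R y x.
Proof.
split; last exact: crel_exr.
move=> s; have [a aE] := crel_approx_sym R s; exists a^-1 => y ys x.
by rewrite aE// ceq_mulVl; split=> /ceq_sym.
Qed.

Definition cinv R := Completion (cinv_subproof R).

Lemma cmulA : associative cmul.
Proof.
move=> R S T; apply: completion_eq => x z /=; split.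
  by move=> [y [[w [xw wy]] yz]]; exists w; split=> //; exists y.
by move=> [w [xw [y [wy yz]]]]; exists y; split=> //; exists w.
Qed.

Lemma cmul1 : left_id cone cmul.
Proof.
move=> R; apply: completion_eq => x z /=; split=> [[y [xy yz]]|xz].
  by apply/(crel_cosetr _ xy).
by exists z; split=> //; exact: ceqxx.
Qed.

Lemma cmulr1 : right_id cone cmul.
Proof.
move=> R; apply: completion_eq => x z /=; split=> [[y [xy yz]]|xz].
  by apply/(crel_cosetl _ yz)/ceq_sym.
by exists x; split=> //; exact: ceqxx.
Qed.

Lemma cmulV : left_inverse cone cinv cmul.
Proof.
move=> R; apply: completion_eq => x z /=; split=> [[y [xy zy]]|xz].
  by apply/(crel_cosetl _ xy).
by have [y xy] := crel_exr R x; exists y; split=> //; apply/(crel_cosetl _ xy).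
Qed.

Lemma cmulVr : right_inverse cone cinv cmul.
Proof.
move=> R; apply: completion_eq => x z /=; split=> [[y [yx yz]]|xz].
  by apply/(crel_cosetr _ yx).
by have [y yx] := crel_exl R x; exists y; split=> //; apply/(crel_cosetr _ yx).
Qed.

End Relations.

HB.instance Definition _ D := gen_eqMixin (completion D).
HB.instance Definition _ D := gen_choiceMixin (completion D).
HB.instance Definition _ D := isGroup.Build (completion D)
  (@cmulA D) (@cmul1 D) (@cmulr1 D) (@cmulV D) (@cmulVr D).

(** * The group topology of the completion *)

Section Topology.
Context {D : completion_data}.
Implicit Types (x y z a n u : D) (R S T : completion D) (U V : set D) (s : seq D).

(** Translations by [U] times the stabilizer of the cosets of [1 :: s]. Controlling the base coset
    ties [u] to [R], as [crel_central] requires. *)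
Definition cball U s : set (completion D) :=
  [set R | exists2 u, U u & forall x, x \in 1 :: s -> R x (u * x)].

Definition cnbhs R : set_system (completion D) :=
  [set A | exists U s, dnear U /\ forall T, cball U s T -> A (R * T)].

Definition central : set D := [set u | forall n, dsub n -> u * n = n * u].

(* [R] moves the base coset like [a], so they differ by an element of the subgroup
   up to approximation; as [u] commutes with it, [R] and [a] conjugate [u] alike. *)
Lemma crel_central R a u x y : R 1 a -> R y x -> central u ->
  R (u * y) (a * u * a^-1 * x).
Proof.
move=> R1 Ryx uC; have [b bE] := crel_approx R [:: 1; y; u * y].
have : ceq (b * 1) a by apply/bE => //; rewrite !inE eqxx.
rewrite mulg1 /ceq => ban.
have : ceq (b * y) x by apply/bE => //; rewrite !inE eqxx orbT.
rewrite /ceq => byx; apply/bE; first by rewrite !inE eqxx !orbT.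
rewrite /ceq; set n := b^-1 * a in ban.
have -> : a = b * n by rewrite /n mulVKg.
have := uC _ ban => un.
suff -> : (b * (u * y))^-1 * (b * n * u * (b * n)^-1 * x) = (b * y)^-1 * x by [].
by rewrite -(mulgA b n u) -un; group.
Qed.

Lemma cball_sub U V s t : U `<=` V -> {subset s <= t} -> cball U t `<=` cball V s.
Proof.
move=> UV st R [u /UV Vu uE]; exists u => // x; rewrite inE => /predU1P[->|/st xt].
  by apply: uE; rewrite inE eqxx.
by apply: uE; rewrite inE xt orbT.
Qed.

Lemma cball1 U s : dnear U -> cball U s 1.
Proof.
by move=> /dnear_one U1; exists 1 => // x _; rewrite mul1g; exact: ceqxx.
Qed.

(** [S] moves [x] to [v * x], where [R] is not controlled directly; but [v] commutes with [dsub], so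
    by [crel_central] [R] sends it on to [u * v * x]. Hence the same list [s] serves throughout. *)
Lemma cball_mul U : dnear U -> exists2 V, dnear V &
  forall s R S, cball V s R -> cball V s S -> cball U s (R * S).
Proof.
move=> /dnear_mul[V nV VV]; exists (V `&` central).
  by apply: filterI => //; exact: dnear_central.
move=> s R S [u [Vu uC] uE] [v [Vv vC] vE]; exists (u * v); first exact: VV.
move=> x xs; exists (v * x); split; first exact: vE.
have R1 : R 1 u by rewrite -[u in R _ u]mulg1; apply: uE; rewrite inE eqxx.
by have := crel_central R1 (uE _ xs) vC; group.
Qed.

Lemma cball_inv U : dnear U -> exists2 V, dnear V &
  forall s R, cball V s R -> cball U s R^-1.
Proof.
move=> nU; exists ([set u | U u^-1] `&` central).
  by apply: filterI; [exact: dnear_inv|exact: dnear_central].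
move=> s R [u [Uu uC] uE]; exists u^-1 => // x xs.
have R1 : R 1 u by rewrite -[u in R _ u]mulg1; apply: uE; rewrite inE eqxx.
have vC : central u^-1.
  by move=> n nN; apply: (mulgI u); rewrite mulVKg mulgA uC// -mulgA mulgV mulg1.
by have := crel_central R1 (uE _ xs) vC; group.
Qed.

(** The conjugate acts at [x] as [T] does at a preimage [f x] under [R], and its translation part is
    [a * u * a^-1], with [a] representing the image of the base coset. *)
Lemma cball_conj R U s : dnear U -> exists V t, dnear V /\
  forall T, cball V t T -> cball U s (R * T * R^-1).
Proof.
move=> nU; have [a R1] := crel_exr R 1; have [f fP] := choice (crel_exl R).
exists ([set u | U (a * u * a^-1)] `&` central), (f 1 :: map f s); split.
  by apply: filterI; [exact: dnear_conj|exact: dnear_central].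
move=> T [u [Uu uC] uE]; exists (a * u * a^-1) => // x xs.
exists (f x); split; first exact: fP.
exists (u * f x); split; last exact: crel_central.
by apply: uE; rewrite inE -map_cons map_f ?orbT.
Qed.

End Topology.

HB.instance Definition _ D := hasNbhs.Build (completion D) (@cnbhs D).

Section TopologyInstance.
Context {D : completion_data}.
Implicit Types (R S T : completion D) (A : set (completion D)).

Lemma cnbhs_filter R : ProperFilter (nbhs R).
Proof.
split; first by move=> [U [s [nU]]] /(_ _ (cball1 s nU)).
split.
- by exists setT, [::]; split=> //; exact: filterT.
- move=> A B [U [s [nU UA]]] [V [t [nV VB]]].
  exists (U `&` V), (s ++ t); split; first exact: filterI.
  move=> T TUV; split.
    by apply/UA; apply: cball_sub TUV => // x xs; rewrite mem_cat xs.
  by apply/VB; apply: cball_sub TUV => // x xs; rewrite mem_cat xs orbT.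
- by move=> A B AB [U [s [nU UA]]]; exists U, s; split=> // T /UA /AB.
Qed.

Lemma cnbhs_singleton R A : nbhs R A -> A R.
Proof. by move=> [U [s [nU]]] /(_ _ (cball1 s nU)); rewrite mulg1. Qed.

Lemma cnbhs_nbhs R A : nbhs R A -> nbhs R (nbhs^~ A).
Proof.
move=> [U [s [nU UA]]]; have [V nV VV] := cball_mul nU.
exists V, s; split=> // T VT; exists V, s; split=> // S VS.
by rewrite -mulgA; apply/UA/VV.
Qed.

HB.instance Definition _ := Nbhs_isNbhsTopological.Build (completion D)
  cnbhs_filter cnbhs_singleton cnbhs_nbhs.

Lemma cmul_continuous :
  continuous (fun xy : completion D * completion D => xy.1 * xy.2).
Proof.
move=> [R S] A /= [U [s [nU UA]]]; have [V nV VV] := cball_mul nU.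
have [W [t [nW WV]]] := cball_conj (S^-1) s nV.
exists ([set X | exists2 T, cball W t T & X = R * T],
        [set X | exists2 T, cball V s T & X = S * T]).
  by split; [exists W, t|exists V, s]; split=> // T ?; exists T.
move=> [_ _] /= [[T WT ->] [T' VT' ->]].
have -> : R * T * (S * T') = R * S * (S^-1 * T * S^-1^-1 * T') by group.
by apply/UA/VV => //; apply: WV.
Qed.

Lemma cinv_continuous : continuous (fun R : completion D => R^-1).
Proof.
move=> R A [U [s [nU UA]]].
have [V [t [nV VU]]] := cball_conj R s nU; have [W nW WV] := cball_inv nV.
exists W, t; split=> // T /WV/VU/UA.
by rewrite /= -/(R^-1) -/((R * T)^-1); group.
Qed.

HB.instance Definition _ := Group_Topological_isTopGroup.Build (completion D)
  cmul_continuous cinv_continuous.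

End TopologyInstance.

(** * Topological groups *)

Section TopGroup.
Implicit Types G H : topGroupType.

Lemma cvg_mulg T (F : set_system T) {FF : Filter F} G (f g : T -> G) (a b : G) :
  f @ F --> a -> g @ F --> b -> (fun x => f x * g x) @ F --> a * b.
Proof.
move=> fa gb.
exact: (cvg_comp2 (h := fun x y => x * y) fa gb (@mulg_continuous G (a, b))).
Qed.

Lemma continuous_nbhs (S T : topologicalType) (f : S -> T) x (U : set T) :
  continuous f -> nbhs (f x) U -> nbhs x (f @^-1` U).
Proof. by move=> cf; exact: cf. Qed.

Lemma mull_continuous G (a : G) : continuous (mul a).
Proof.
move=> x; exact: (cvg_mulg (F := nbhs x) (@cvg_cst _ a _ _ _) (@cvg_id _ (nbhs x))).
Qed.

Lemma mulr_continuous G (a : G) : continuous (mul^~ a).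
Proof.
move=> x; exact: (cvg_mulg (F := nbhs x) (@cvg_id _ (nbhs x)) (@cvg_cst _ a _ _ _)).
Qed.

Lemma nbhs_translate G (x : G) (A : set G) :
  nbhs x A <-> nbhs 1 [set y | A (x * y)].
Proof.
split=> [xA|/= A1].
  by have := @mull_continuous G x 1; rewrite /continuous_at mulg1 => /(_ _ xA).
have xA : nbhs x (mul x^-1 @^-1` [set y | A (x * y)]).
  by apply: mull_continuous; rewrite mulVg.
by apply: filterS xA => y /=; rewrite mulVKg.
Qed.

(** If [p] and [q] are inseparable, a point [z] close to both writes [p^-1 * q] as
    [(p^-1 * z) * (z^-1 * q)], a product of two elements near [1]. *)
Lemma hausdorff_group G :
  (forall x : G, (forall A, nbhs (1 : G) A -> A x) -> x = 1) -> hausdorff_space G.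
Proof.
move=> sep p q pq; suff : p^-1 * q = 1 by move=> /(congr1 (mul p)); group.
apply: sep => A A1.
have := @mulg_continuous G (p^-1 * p, q^-1 * q).
rewrite /continuous_at /= !mulVg mulg1 => /(_ _ A1)[[P Q] [/= pP qQ] PQ].
have pP' : nbhs p [set z | P (p^-1 * z)] by apply: mull_continuous; rewrite mulVg.
have qQ' : nbhs q [set z | Q (z^-1 * q)].
  have /invg_continuous : nbhs q^-1 (mul^~ q @^-1` Q).
    by apply: mulr_continuous; rewrite mulVg.
  exact.
have [z [Pz Qz]] := pq _ _ pP' qQ'; have := PQ (p^-1 * z, z^-1 * q) (conj Pz Qz).
by rewrite /=; group.
Qed.

Lemma locally_compact_group_nbhs1 G (K : set G) :
  hausdorff_space G -> compact K -> nbhs (1 : G) K -> locally_compact_group G.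
Proof.
move=> hG cK K1; split=> // x _; rewrite withinET.
have cxK : compact [set x * y | y in K].
  apply: continuous_compact => //; apply: continuous_subspaceT => y.
  exact: mull_continuous.
exists [set x * y | y in K]; last by split=> //; exact: compact_closed.
by apply/nbhs_translate; apply: filterS K1 => y Ky; exists y.
Qed.

Lemma hom1 (G H : groupType) (f : G -> H) : hom f -> f 1 = 1.
Proof. by move=> fM; apply: (mulgI (f 1)); rewrite -fM// !mulg1. Qed.

Lemma homV (G H : groupType) (f : G -> H) x : hom f -> f x^-1 = (f x)^-1.
Proof. by move=> fM; apply: (mulgI (f x)); rewrite -fM// !mulgV hom1. Qed.

Lemma continuous_hom G H (f : G -> H) : hom f ->
  (forall A, nbhs (1 : H) A -> nbhs (1 : G) (f @^-1` A)) -> continuous f.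
Proof.
move=> fM f1 x A /nbhs_translate/f1 A1; apply/nbhs_translate.
by apply: filterS A1 => y; rewrite /= fM.
Qed.

Lemma open_hom G H (f : G -> H) (V : set G) : hom f ->
  (forall A, nbhs (1 : G) A -> nbhs (1 : H) (f @` A)) -> open V -> open (f @` V).
Proof.
move=> fM f1; rewrite !openE => Vo _ [x /Vo/nbhs_translate/f1 A1 <-].
apply/nbhs_translate; apply: filterS A1 => _ [y /= Vy <-].
by exists (x * y) => //; rewrite fM.
Qed.

Lemma discrete_subgroup G (S A : set G) : is_subgroup S ->
  nbhs (1 : G) A -> A `&` S `<=` [set 1] -> discrete_subset S.
Proof.
move=> [S1 [SM SV]] A1 AS s Ss.
exists (interior [set y | A (s^-1 * y)]); split; first exact: open_interior.
  by apply/nbhs_translate => /=; apply: filterS A1 => y; rewrite /= mulKg.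
apply/seteqP; split=> [y [/interior_subset Ay Sy] /=|_ ->].
  have sy1 : s^-1 * y = 1 := AS _ (conj Ay (SM _ _ (SV _ Ss) Sy)).
  by rewrite -(mulVKg s y) sy1 mulg1.
split=> //; apply/nbhs_translate => /=; apply: filterS A1 => y; rewrite /= mulKg//.
Qed.

End TopGroup.

Lemma compact_mulg (G : topGroupType) (A B : set G) : compact A -> compact B ->
  compact [set x | exists a b, A a /\ B b /\ x = a * b].
Proof.
move=> cA cB.
have -> : [set x | exists a b, A a /\ B b /\ x = a * b] =
    (fun z : G * G => z.1 * z.2) @` (A `*` B).
  apply/seteqP; split=> [x [a [b [Aa [Bb ->]]]]|_ [[a b] [Aa Bb] <-]].
    by exists (a, b).
  by exists a, b.
apply: continuous_compact; last exact: compact_setX.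
by apply: continuous_subspaceT; exact: mulg_continuous.
Qed.

(** * Compactness of stabilizers *)

Lemma ultra_bigcup T (I : eqType) (F : set_system T) {UF : UltraFilter F}
    (s : seq I) (P : I -> set T) :
  F [set x | exists2 i, i \in s & P i x] ->
  exists2 i, i \in s & F (P i).
Proof.
elim: s => [|i s IH] Fs.
  by have [x [j]] := filter_ex Fs; rewrite in_nil.
have [FP|FP] := in_ultra_setVsetC (P i) UF; first by exists i; rewrite ?mem_head.
have [|j js FPj] := IH; last by exists j; rewrite // inE js orbT.
apply: filterS (filterI Fs FP) => x [[j]].
by rewrite inE => /predU1P[->//|js Pj _]; exists j.
Qed.

Lemma filter_forall_in T (I : eqType) (F : set_system T) {FF : Filter F}
    (s : seq I) (P : I -> set T) :
  (forall i, i \in s -> F (P i)) -> F [set x | forall i, i \in s -> P i x].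
Proof.
elim: s => [|i s IH] FP; first by apply: filterS filterT => x _ j; rewrite in_nil.
have Fs : F [set x | forall i, i \in s -> P i x].
  by apply: IH => j js; apply: FP; rewrite inE js orbT.
apply: filterS (filterI (FP i (mem_head i s)) Fs) => x [Pi Ps] j.
by rewrite inE => /predU1P[->|/Ps].
Qed.

Section Embedding.
Context {D : completion_data}.
Implicit Types (x y z a n u : D) (R S T : completion D) (U V : set D) (s : seq D).

Lemma emb_subproof a : rel_approx (fun x y => ceq (a * x) y) /\
  forall y, exists x, ceq (a * x) y.
Proof.
split=> [s|y]; first by exists a.
by exists (a^-1 * y); rewrite mulVKg; exact: ceqxx.
Qed.

Definition emb a := Completion (emb_subproof a).

Lemma emb_hom : hom emb.
Proof.
move=> a b _ _; apply: completion_eq => x z /=; split=> [abx|[y [bx ay]]].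
  by exists (b * x); split; [exact: ceqxx|rewrite mulgA].
by apply: ceq_trans ay; rewrite -mulgA; exact/ceq_mull.
Qed.

Definition stab s : set (completion D) := [set R | forall x, x \in 1 :: s -> R x x].

Lemma stab_inv s R : stab s R -> stab s R^-1.
Proof. by move=> sR x /sR. Qed.

Lemma stab_cball U s : dnear U -> stab s `<=` cball U s.
Proof. by move=> /dnear_one U1 R sR; exists 1 => // x /sR; rewrite mul1g. Qed.

Section Limit.
Variable F : set_system (completion D).
Context {FF : ProperFilter F}.
Hypothesis limr : forall x, exists y, F [set R | R x y].
Hypothesis liml : forall y, exists x, F [set R | R x y].

(** The pointwise limit of a filter under which each coset has an eventually constant image; the
    hypothesis on preimages makes this limit surjective. *)
Lemma clim_subproof : rel_approx (fun x y => F [set R | R x y]) /\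
  forall y, exists x, F [set R | R x y].
Proof.
split=> // s; have [f Ff] := choice limr.
have Fs : F [set R | forall x, x \in s -> R x (f x)].
  exact: (filter_forall_in (P := fun x => [set R : completion D | R x (f x)])
    (fun x _ => Ff x)).
(* A single [R] realises the limit on all of [s], so what approximates [R] there approximates the
   limit. *)
have [R Rf] := filter_ex Fs; have [a aE] := crel_approx R s.
exists a => x xs y; have afx : ceq (a * x) (f x) by apply/aE => //; exact: Rf.
split=> [Fxy|axy].
  have [S [Sx Sy]] := filter_ex (filterI (Ff x) Fxy).
  by apply: ceq_trans afx _; apply/(crel_cosetr _ Sx).
apply: filterS (Ff x) => S /= Sx; apply/(crel_cosetr _ Sx).
exact: ceq_trans (ceq_sym afx) axy.
Qed.

Definition clim := Completion clim_subproof.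

(** Eventually [clim^-1 * R] fixes the cosets of [1 :: s], and such a stabilizer lies in the
    ball. *)
Lemma cvg_clim : F --> clim.
Proof.
move=> A [U [s [nU UA]]]; have [f Ff] := choice limr.
have Fs : F [set R | forall x, x \in 1 :: s -> R x (f x)].
  exact: (filter_forall_in (P := fun x => [set R : completion D | R x (f x)])
    (fun x _ => Ff x)).
apply: filterS Fs => R Rf; rewrite -(mulVKg clim R); apply: UA.
apply: stab_cball => // x xs; exists (f x); split; first exact: Rf.
exact: Ff.
Qed.

End Limit.

Definition finite_orbits := forall x, exists s : seq D, forall n, dsub n ->
  exists2 y, y \in s & ceq (n * x) y.

(** An element fixing the base coset is approximated by elements of [dsub], so its orbits are no
    larger than those of [dsub]. *)
Lemma stab_orbit s x : finite_orbits -> exists t : seq D, forall R, stab s R ->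
  exists2 y, y \in t & R x y.
Proof.
move=> /(_ x)[t tP]; exists t => R sR.
have [a [aE xE]] := crel_approx2 R 1 x.
have /aE : R 1 1 by apply: sR; exact: mem_head.
rewrite mulg1 => /ceq_sym; rewrite /ceq invg1 mul1g => /tP[y yt axy].
by exists y => //; apply/xE.
Qed.

(** An ultrafilter on the stabilizer selects one of the finitely many possible images of each coset,
    and likewise one preimage; these selections define its limit. *)
Lemma compact_stab s : finite_orbits -> compact (stab s).
Proof.
move=> fin; rewrite compact_ultra => F UF Fs.
have lr x : exists y, F [set R | R x y].
  have [t tP] := stab_orbit s x fin.
  suff [y _ Fy] : exists2 y, y \in t & F [set R | R x y] by exists y.
  apply: ultra_bigcup; apply: filterS Fs => R /tP[y yt Rxy].
  by exists y.
have ll y : exists x, F [set R | R x y].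
  have [t tP] := stab_orbit s y fin.
  suff [x _ Fx] : exists2 x, x \in t & F [set R | R x y] by exists x.
  apply: ultra_bigcup; apply: filterS Fs => R /stab_inv/tP[x xt Rxy].
  by exists x.
exists (clim lr ll); split; last exact: cvg_clim.
by move=> x xs /=; apply: filterS Fs => R; exact.
Qed.

(** The hypotheses say that [dsub] is discrete and closed for [dnear]. If [R] lies in every ball,
    closedness makes it fix the base coset; then the [u] by which it moves [x] lies in [dsub], hence
    is [1]. *)
Lemma hausdorff_completion :
  (exists2 U, dnear U & forall u, U u -> dsub u -> u = 1) ->
  (forall a, (forall U, dnear U -> exists2 u, U u & ceq a u) -> dsub a) ->
  hausdorff_space (completion D).
Proof.
move=> [U nU U1] sep; apply: hausdorff_group => R R1.
have ball V s : dnear V -> cball V s R.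
  move=> nV; apply: R1; exists V, s; split=> // T; rewrite mul1g; exact.
have R11 : R 1 1.
  have [a aR] := crel_exr R 1; apply/(crel_cosetr _ aR)/ceq_sym.
  rewrite /ceq invg1 mul1g; apply: sep => V /(ball _ [::])[u Vu uE].
  exists u => //; apply/(crel_cosetr _ aR).
  by rewrite -[u]mulg1; apply: uE; exact: mem_head.
apply: completion_eq => x y; suff Rxx : R x x by exact: crel_cosetr.
have [u Uu uE] := ball _ [:: x] nU.
have : R 1 (u * 1) by apply: uE; exact: mem_head.
rewrite mulg1 => /(crel_cosetr _ R11); rewrite /ceq invg1 mul1g => /(U1 _ Uu) u1.
by rewrite -{2}[x]mul1g -u1; apply: uE; rewrite !inE eqxx orbT.
Qed.

Lemma nbhs_completion1 (A : set (completion D)) :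
  nbhs (1 : completion D) A <-> exists U s, dnear U /\ cball U s `<=` A.
Proof.
by split=> -[U [s [nU UA]]]; exists U, s; split=> // R /UA; rewrite mul1g.
Qed.

Lemma cball_emb U s R : cball U s R ->
  exists2 u, U u & exists2 S, stab s S & R = emb u * S.
Proof.
move=> [u Uu uE]; exists u => //; exists ((emb u)^-1 * R); last by rewrite mulVKg.
by move=> x xs; exists (u * x); split; [exact: uE|exact: ceqxx].
Qed.

End Embedding.

(** * The Schlichting completion *)

Section Schlichting.
Variables (Gam : groupType) (L : set Gam).
Hypothesis Lsub : is_subgroup L.

(** Neighbourhoods of [1] in the discrete topology: balls then shrink to stabilizers, which gives
    the topology of pointwise convergence. *)
Definition principal1 : set_system Gam := [set S | S 1].

Lemma principal1_filter : Filter principal1.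
Proof. by split=> // P Q PQ /PQ. Qed.

Lemma principal1_mul U : principal1 U ->
  exists2 V, principal1 V & forall u v, V u -> V v -> U (u * v).
Proof. by move=> U1; exists [set 1] => // _ _ -> ->; rewrite mulg1. Qed.

Lemma principal1_inv U : principal1 U -> principal1 [set u | U u^-1].
Proof. by rewrite /principal1 /= invg1. Qed.

Lemma principal1_conj a U : principal1 U -> principal1 [set u | U (a * u * a^-1)].
Proof. by rewrite /principal1 /= mulg1 mulgV. Qed.

Lemma principal1_central :
  principal1 [set u | forall n, L n -> u * n = n * u].
Proof. by move=> n _; rewrite mul1g mulg1. Qed.

Definition discrete_data : completion_data := @CompletionData Gam L principal1
  Lsub principal1_filter (fun U => id) principal1_mul principal1_inv
  principal1_conj principal1_central.

Notation Q := (completion discrete_data).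

Lemma hausdorff_discrete_data : hausdorff_space Q.
Proof.
apply: hausdorff_completion; first by exists [set 1].
by move=> a /(_ [set 1] erefl)[_ ->] /ceq_sym; rewrite /ceq invg1 mul1g.
Qed.

Lemma nbhs_discrete_data (R : Q) (A : set Q) :
  nbhs R A <-> exists s : seq Gam, forall T, @stab discrete_data s T -> A (R * T).
Proof.
split=> [[U [s [U1 UA]]]|[s sA]].
  by exists s => T sT; apply: UA; exact: stab_cball.
exists [set 1], s; split=> // T [_ -> Ts]; apply: sA => x /Ts.
by rewrite mul1g.
Qed.

Lemma lcosetE x : lcoset x L = [set y | @ceq discrete_data x y].
Proof.
apply/seteqP; split=> [_ [h Lh <-]|y xy] /=; first by rewrite /ceq /= mulKg.
by exists (x^-1 * y) => //; rewrite mulVKg.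
Qed.

Lemma lcoset_eq x y : @ceq discrete_data x y -> lcoset x L = lcoset y L.
Proof.
move=> xy; rewrite !lcosetE; apply/seteqP; split=> z /=.
  exact: ceq_trans (ceq_sym xy).
exact: ceq_trans xy.
Qed.

Lemma lmul_lcoset g x : lmul_set g (lcoset x L) = lcoset (g * x) L.
Proof.
apply/seteqP; split=> [_ [_ [h Lh <-] <-]|_ [h Lh <-]].
  by exists h => //; rewrite mulgA.
by exists (x * h); [exists h|rewrite mulgA].
Qed.

Definition coset_image (R : Q) (C : set Gam) : set Gam :=
  [set y | exists2 x, C x & R x y].

Lemma coset_image_lcoset (R : Q) x : coset_image R (lcoset x L) = [set y | R x y].
Proof.
apply/seteqP; split=> [y [z]|y xy].
  by rewrite lcosetE => xz zy; apply/(crel_cosetl _ zy)/ceq_sym.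
by exists x => //; rewrite lcosetE; exact: ceqxx.
Qed.

Lemma coset_imageE (R : Q) x y : R x y -> coset_image R (lcoset x L) = lcoset y L.
Proof.
move=> xy; rewrite coset_image_lcoset lcosetE.
by apply/seteqP; split=> z /(crel_cosetr _ xy).
Qed.

Lemma coset_image_inj (R : Q) x y :
  coset_image R (lcoset x L) = coset_image R (lcoset y L) -> lcoset x L = lcoset y L.
Proof.
have [z yz] := crel_exr R y; rewrite !coset_image_lcoset => exy.
have : [set z | R y z] z by [].
by rewrite -exy => /(crel_cosetl _ yz)/lcoset_eq.
Qed.

Lemma lcoset_completion (sigma : set Gam -> set Gam) :
  (forall C, is_lcoset L C -> is_lcoset L (sigma C)) ->
  (forall C, is_lcoset L C -> exists2 C', is_lcoset L C' & sigma C' = C) ->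
  (forall s : seq Gam, exists g : Gam,
     forall x, x \in s -> sigma (lcoset x L) = lmul_set g (lcoset x L)) ->
  rel_approx (fun x y : discrete_data => sigma (lcoset x L) y) /\
  forall y, exists x, sigma (lcoset x L) y.
Proof.
move=> sL sS sA; split=> [s|y].
  have [g gE] := sA s; exists g => x xs y.
  by rewrite gE// lmul_lcoset lcosetE.
have [|_ [x ->] xy] := sS (lcoset y L); first by exists y.
by exists x; rewrite xy lcosetE; exact: ceqxx.
Qed.

Lemma schlichting_completion_discrete : schlichting_completion L (@emb discrete_data).
Proof.
exists coset_image; split.
- split; [|split].
  + by move=> R _ [x ->]; have [y xy] := crel_exr R x; exists y; exact: coset_imageE.
  + move=> R _ [y ->]; have [x xy] := crel_exl R y.
    by exists (lcoset x L); [exists x|exact: coset_imageE].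
  + by move=> R _ _ [x ->] [y ->]; exact: coset_image_inj.
- split=> [R S _ [x ->]|R S RS].
    apply/seteqP; split=> [z [x' xx' [y [Sx Ry]]]|z [y [x' xx' Sx] Ry]].
      by exists y => //; exists x'.
    by exists x' => //; exists y.
  apply: completion_eq => x y.
  have : coset_image R (lcoset x L) = coset_image S (lcoset x L) by apply: RS; exists x.
  by rewrite !coset_image_lcoset => /seteqP[RS1 RS2]; split=> [/RS1|/RS2].
- move=> g _ [x ->]; rewrite lmul_lcoset; apply: coset_imageE.
  exact: ceqxx.
- move=> sigma; split=> [[sL [sS [_ sA]]]|[R RE]].
    exists (Completion (lcoset_completion sL sS sA)) => _ [x ->].
    by rewrite coset_image_lcoset.
  split; [|split; [|split]].
  + move=> _ [x ->]; rewrite -RE; last by exists x.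
    by have [y xy] := crel_exr R x; exists y; exact: coset_imageE.
  + move=> _ [y ->]; have [x xy] := crel_exl R y.
    by exists (lcoset x L); [exists x|rewrite -RE ?(coset_imageE xy)//; exists x].
  + move=> _ _ [x ->] [y ->]; rewrite -!RE; [exact: coset_image_inj|by exists y|by exists x].
  + move=> s; have [g gE] := crel_approx R s; exists g => x xs.
    rewrite -RE; last by exists x.
    by rewrite lmul_lcoset; apply: coset_imageE; apply/gE => //; exact: ceqxx.
- move=> R A; split=> [/nbhs_discrete_data[s sA]|[s sA]].
    (* [stab] also fixes the base coset, so agreement at [1] is required as well. *)
    exists (1 :: s) => T TR; rewrite -(mulVKg R T); apply: sA => x xs.
    have [y xy] := crel_exr R x; exists y; split=> //.
    have : [set z | R x z] y by [].
    by rewrite -coset_image_lcoset -TR// coset_image_lcoset.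
  apply/nbhs_discrete_data; exists s => T sT; apply: sA => x xs.
  have [y xy] := crel_exr R x; rewrite (coset_imageE xy); apply: coset_imageE.
  by exists x; split=> //; apply: sT; rewrite inE xs orbT.
Qed.

End Schlichting.

(** * Finite index subgroups and semidirect products *)

Section FiniteIndex.
Implicit Types G : groupType.

Lemma hom_on1 G G' (D : set G) (f : G -> G') : D 1 -> hom_on D f -> f 1 = 1.
Proof. by move=> D1 fM; apply: (mulgI (f 1)); rewrite -fM// !mulg1. Qed.

Lemma hom_onV G G' (D : set G) (f : G -> G') x :
  is_subgroup D -> hom_on D f -> D x -> f x^-1 = (f x)^-1.
Proof.
move=> [D1 [_ DV]] fM Dx; apply: (mulgI (f x)).
by rewrite -fM ?mulgV ?(hom_on1 D1 fM)//; exact: DV.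
Qed.

Lemma subgroup_image G G' (D : set G) (f : G -> G') :
  is_subgroup D -> hom_on D f -> is_subgroup (f @` D).
Proof.
move=> Dsub fM; have [D1 [DM DV]] := Dsub; split; [|split].
- by exists 1 => //; exact: hom_on1 fM.
- by move=> _ _ [x Dx <-] [y Dy <-]; exists (x * y); [exact: DM|rewrite fM].
- by move=> _ [x Dx <-]; exists x^-1; [exact: DV|rewrite (hom_onV Dsub)].
Qed.

Lemma subgroup_preim G G' (D : set G) (f : G -> G') (H : set G') :
  is_subgroup D -> is_subgroup H -> hom_on D f ->
  is_subgroup [set x | D x /\ H (f x)].
Proof.
move=> Dsub [H1 [HM HV]] fM; have [D1 [DM DV]] := Dsub.
split; [|split].
- by split=> //; rewrite (hom_on1 D1 fM).
- by move=> x y [Dx Hx] [Dy Hy]; split; [exact: DM|rewrite fM//; exact: HM].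
- by move=> x [Dx Hx]; split; [exact: DV|rewrite (hom_onV Dsub)//; exact: HV].
Qed.

Lemma finite_index_trans G (H K L : set G) : is_subgroup L ->
  finite_index H K -> finite_index K L -> finite_index H L.
Proof.
move=> [_ [LM _]] [HK [s [sK sP]]] [KL [t [tL tP]]].
split; first exact: subset_trans KL.
exists [seq x * y | x <- t, y <- s]; split=> [_ /allpairsP[[x y] [/tL xL /sK/KL yL ->]]|k].
  exact: LM.
move=> /tP[x xt /sP[y ys xyk]]; exists (x * y); first by apply/allpairsP; exists (x, y).
by move: xyk; group.
Qed.

Lemma finite_index_preim G G' (D : set G) (f : G -> G') (H K : set G') :
  is_subgroup D -> is_subgroup H -> hom_on D f -> (forall x, D x -> K (f x)) ->
  finite_index H K -> finite_index [set x | D x /\ H (f x)] D.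
Proof.
move=> Dsub [_ [HM HV]] fM fK [_ [s [_ sP]]]; have [D1 [DM DV]] := Dsub.
split; first by move=> x [].
(* [d x] is an element of [D] with image in the coset of [x], if there is one, and [1] by
   default. *)
have /choice[d dP] : forall x : G', exists z, D z /\
    forall y, D y -> H (x^-1 * f y) -> H (x^-1 * f z).
  move=> x.
  have [[y [Dy Hy]]|no] := pselect (exists y, D y /\ H (x^-1 * f y)).
    by exists y.
  by exists 1; split=> // y Dy Hy; case: no; exists y.
exists (map d s); split=> [_ /mapP[x _ ->]|k Dk]; first by case: (dP x).
have [x xs Hx] := sP _ (fK _ Dk); exists (d x); first exact: map_f.
have [Ddx Hdx] := dP x; split; first exact: DM (DV _ Ddx) Dk.
rewrite fM ?(hom_onV Dsub)//; last exact: DV.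
by have := HM _ _ (HV _ (Hdx _ Dk Hx)) Hx; group.
Qed.

Lemma finite_indexI G (D H K : set G) : is_subgroup D -> is_subgroup H ->
  D `<=` K -> finite_index H K -> finite_index (D `&` H) D.
Proof.
move=> Dsub Hsub DK HK.
exact: (@finite_index_preim _ _ D id H K Dsub Hsub (fun _ _ _ _ => erefl) DK HK).
Qed.

End FiniteIndex.

Record group_action (Gam E : groupType) := GroupAction {
  gact :> Gam -> E -> E;
  gactM : forall g, hom (gact g);
  gact_mul : forall g h v, gact (g * h) v = gact g (gact h v);
  gact1 : forall v, gact 1 v = v
}.

Section ActionTheory.
Context {Gam E : groupType} (Del : group_action Gam E).

Lemma gactMg g v w : Del g (v * w) = Del g v * Del g w.
Proof. exact: gactM. Qed.

Lemma gact1g g : Del g 1 = 1. Proof. exact/hom1/gactM. Qed.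

Lemma gactVg g v : Del g v^-1 = (Del g v)^-1. Proof. exact/homV/gactM. Qed.

Lemma gactK g v : Del g^-1 (Del g v) = v.
Proof. by rewrite -gact_mul mulVg gact1. Qed.

Lemma gactVK g v : Del g (Del g^-1 v) = v.
Proof. by rewrite -gact_mul mulgV gact1. Qed.

End ActionTheory.

Record sdprod (Gam E : groupType) (Del : group_action Gam E) :=
  Sd { sdl : E; sdr : Gam }.

Arguments Sd {Gam E Del} sdl sdr.

Section SemidirectProduct.
Context {Gam E : groupType} (Del : group_action Gam E).
Implicit Types x y z : sdprod Del.

Definition sdmul x y : sdprod Del := Sd (sdl x * Del (sdr x) (sdl y)) (sdr x * sdr y).
Definition sdone : sdprod Del := Sd 1 1.
Definition sdinv x : sdprod Del := Sd (Del (sdr x)^-1 (sdl x)^-1) (sdr x)^-1.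

Lemma sdmulA : associative sdmul.
Proof. by move=> x y z; rewrite /sdmul /= gactMg gact_mul !mulgA. Qed.

Lemma sdmul1 : left_id sdone sdmul.
Proof. by case=> v g; rewrite /sdmul /= gact1 !mul1g. Qed.

Lemma sdmulr1 : right_id sdone sdmul.
Proof. by case=> v g; rewrite /sdmul /= gact1g !mulg1. Qed.

Lemma sdmulV : left_inverse sdone sdinv sdmul.
Proof. by case=> v g; rewrite /sdmul /= -gactMg !mulVg gact1g. Qed.

Lemma sdmulVr : right_inverse sdone sdinv sdmul.
Proof. by case=> v g; rewrite /sdmul /= gactVK !mulgV. Qed.

HB.instance Definition _ := gen_eqMixin (sdprod Del).
HB.instance Definition _ := gen_choiceMixin (sdprod Del).
HB.instance Definition _ := isGroup.Build (sdprod Del)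
  sdmulA sdmul1 sdmulr1 sdmulV sdmulVr.

End SemidirectProduct.

Section SemidirectTheory.
Context {Gam E : groupType} {Del : group_action Gam E}.
Implicit Types (v w : E) (g h : Gam).
Notation sd := (@Sd Gam E Del).

Lemma sdmulE v g w h : sd v g * sd w h = sd (v * Del g w) (g * h).
Proof. by []. Qed.

Lemma sdinvE v g : (sd v g)^-1 = sd (Del g^-1 v^-1) g^-1.
Proof. by []. Qed.

Lemma sdlM v w : sd (v * w) 1 = sd v 1 * sd w 1.
Proof. by rewrite sdmulE gact1 mulg1. Qed.

Lemma sdlV v : sd v^-1 1 = (sd v 1)^-1.
Proof. by rewrite sdinvE invg1 gact1. Qed.

Lemma sdlJ v g w : sd v g * sd w 1 * (sd v g)^-1 = sd (v * Del g w * v^-1) 1.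
Proof. by rewrite sdinvE !sdmulE mulg1 gactVK mulgV. Qed.

End SemidirectTheory.

(** * The extension of the Schlichting completion *)

Section Extension.
Variables (Gam : groupType) (E : topGroupType) (Del : group_action Gam E).
Variables (L : set Gam) (rho : Gam -> E).
Hypothesis Lsub : is_subgroup L.
Hypothesis rhoM : hom_on L rho.
Hypothesis Del_continuous : forall g, continuous (Del g).
Hypothesis DelL : forall h, L h -> forall e, Del h e = rho h * e * (rho h)^-1.

(** For [h] in [L], this says that [twist h] fixes the coset of [sd v g] modulo [twisted], whatever
    [v] is. *)
Definition intertwined (g h : Gam) :=
  L (g^-1 * h * g) /\ Del g^-1 (rho h) = rho (g^-1 * h * g).

Hypothesis intertwined_index :
  forall g, exists2 M, finite_index M L & forall h, M h -> intertwined g h.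
Hypothesis intertwined_open : forall g, exists F : seq Gam,
  forall h, L h -> (forall x, x \in F -> L (x^-1 * h * x)) -> intertwined g h.

Notation A := (sdprod Del).
Notation sd := (@Sd Gam E Del).

Let L1 : L 1. Proof. by case: Lsub. Qed.
Let LM x y : L x -> L y -> L (x * y). Proof. by case: Lsub => _ [+ _]; exact. Qed.
Let LV x : L x -> L x^-1. Proof. by case: Lsub => _ [_]; exact. Qed.
Let rho1 : rho 1 = 1. Proof. exact: hom_on1 rhoM. Qed.
Let rhoV x : L x -> rho x^-1 = (rho x)^-1. Proof. exact: hom_onV. Qed.

Definition twist (h : Gam) : A := sd (rho h)^-1 h.

Lemma twistM h k : L h -> L k -> twist (h * k) = twist h * twist k.
Proof. by move=> Lh Lk; rewrite /twist sdmulE DelL// rhoM//; congr Sd; group. Qed.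

Lemma twistV h : L h -> twist h^-1 = (twist h)^-1.
Proof.
by move=> Lh; rewrite /twist sdinvE rhoV// DelL ?rhoV//; [congr Sd; group|exact: LV].
Qed.

(** [h] acts on [E] as conjugation by [rho h], which the component [(rho h)^-1] cancels. *)
Lemma twist_central h v : L h -> sd v 1 * twist h = twist h * sd v 1.
Proof.
by move=> Lh; rewrite /twist !sdmulE gact1 DelL// mul1g mulg1; congr Sd; group.
Qed.

Lemma twist_mul h v g : L h -> intertwined g h ->
  twist h * sd v g = sd v g * twist (g^-1 * h * g).
Proof.
move=> Lh [Lg rhog]; rewrite /twist !sdmulE DelL// -rhog gactVg gactVK.
by congr Sd; group.
Qed.

Definition twisted : set A := [set x | exists2 h, L h & x = twist h].

Lemma twisted_subgroup : is_subgroup twisted.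
Proof.
split; [|split].
- by exists 1 => //; rewrite /twist rho1 invg1.
- by move=> _ _ [h Lh ->] [k Lk ->]; exists (h * k); [exact: LM|rewrite twistM].
- by move=> _ [h Lh ->]; exists h^-1; [exact: LV|rewrite twistV].
Qed.

Lemma twistedE v g : twisted (sd v g) <-> L g /\ v = (rho g)^-1.
Proof. by split=> [[h Lh [-> ->]]//|[Lg ->]]; exists g. Qed.

Definition near1 : set_system A := [set U | nbhs (1 : E) [set v | U (sd v 1)]].

Lemma near1_filter : Filter near1.
Proof.
split; rewrite /near1 /=; first exact: filterT.
  by move=> U V nU nV; apply: filterS (filterI nU nV).
by move=> U V UV; apply: filterS => v /UV.
Qed.

Lemma near1_one U : near1 U -> U 1. Proof. exact: nbhs_singleton. Qed.

Lemma near1_image (B : set E) : nbhs (1 : E) B -> near1 [set sd v 1 | v in B].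
Proof. by rewrite /near1 /=; apply: filterS => v Bv; exists v. Qed.

Lemma near1_mul U : near1 U ->
  exists2 V, near1 V & forall u v, V u -> V v -> U (u * v).
Proof.
move=> nU; have := @mulg_continuous E (1, 1); rewrite /continuous_at /= mulg1.
move=> /(_ _ nU)[[P R] [/= nP nR] PR].
exists [set sd v 1 | v in P `&` R]; first by apply: near1_image; exact: filterI.
move=> _ _ [v [Pv _] <-] [w [_ Rw] <-]; rewrite -sdlM.
by apply: (PR (v, w)).
Qed.

Lemma near1_inv U : near1 U -> near1 [set u | U u^-1].
Proof.
move=> nU; rewrite /near1 /=.
have nV : nbhs (1 : E) ((fun v : E => v^-1) @^-1` [set v | U (sd v 1)]).
  by apply: continuous_nbhs; [exact: invg_continuous|rewrite invg1].
by apply: filterS nV => v; rewrite /= sdlV.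
Qed.

Lemma near1_conj a U : near1 U -> near1 [set u | U (a * u * a^-1)].
Proof.
case: a => v g nU; rewrite /near1 /=.
have n1 : nbhs v (mul^~ v^-1 @^-1` [set v | U (sd v 1)]).
  by apply: continuous_nbhs; [exact: mulr_continuous|rewrite mulgV].
have n2 : nbhs (1 : E) (mul v @^-1` (mul^~ v^-1 @^-1` [set v | U (sd v 1)])).
  by apply: continuous_nbhs; [exact: mull_continuous|rewrite mulg1].
suff : nbhs (1 : E) (Del g @^-1` (mul v @^-1` (mul^~ v^-1 @^-1` [set v | U (sd v 1)]))).
  by apply: filterS => w /=; rewrite sdlJ.
by apply: continuous_nbhs; [exact: Del_continuous|rewrite gact1g].
Qed.

Lemma near1_central : near1 [set u | forall n, twisted n -> u * n = n * u].
Proof.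
rewrite /near1 /=; apply: filterS filterT => v _ _ [h Lh ->].
exact: twist_central.
Qed.

Definition extension_data : completion_data := @CompletionData A twisted near1
  twisted_subgroup near1_filter near1_one near1_mul near1_inv near1_conj near1_central.

Notation G := (completion extension_data).
Notation Q := (completion (discrete_data Lsub)).
Notation embA := (@emb extension_data).
Notation ceqA := (@ceq extension_data).
Notation embL := (@emb (discrete_data Lsub)).
Notation ceqL := (@ceq (discrete_data Lsub)).

Lemma ceqA_l v w : ceqA (sd v 1) (sd w 1) -> v = w.
Proof.
rewrite /ceq /= -sdlV -sdlM => /twistedE[_]; rewrite rho1 invg1 => /(congr1 (mul v)).
by group.
Qed.

Lemma emb_l1 v w : embA (sd v 1) 1 (sd w 1) <-> v = w.
Proof.
change (ceqA (sd v 1 * 1) (sd w 1) <-> v = w); rewrite mulg1.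
by split=> [/ceqA_l//|->]; exact: ceqxx.
Qed.

(** By [twist_mul] the twists of [M] fix the coset of [sd v g], so coset representatives of [M] in
    [L] already give the whole orbit. *)
Lemma finite_orbits_extension : @finite_orbits extension_data.
Proof.
move=> [v g]; have [M [_ [s [sL sM]]] Mg] := intertwined_index g.
exists (map (fun k => twist k * sd v g) s) => _ [h Lh ->].
have [k ks Mkh] := sM _ Lh; exists (twist k * sd v g).
  by apply/mapP; exists k.
have Lkh : L (k^-1 * h) by apply: LM => //; apply/LV/sL.
have -> : twist h = twist k * twist (k^-1 * h).
  by rewrite -twistM ?mulVKg//; exact: sL.
rewrite -(mulgA (twist k)) (twist_mul _ Lkh) ?mulgA; last exact: Mg.
apply/ceq_sym/ceq_mulr; exists (g^-1 * k^-1 * h * g) => //.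
by have [] := Mg _ Mkh; rewrite !mulgA.
Qed.

(** As [twisted] projects onto [L], cosets of [twisted] map to cosets of [L]; this describes the
    fibres. *)
Lemma ceqA_fiber (a : A) y : (exists v, ceqA a (sd v y)) <-> ceqL (sdr a) y.
Proof.
case: a => w g; rewrite /ceq /=; split=> [[v]|Lgy].
  by rewrite sdinvE sdmulE => /twistedE[].
(* The first component of [sd w g * twist (g^-1 * y)]. *)
exists (w * Del g (rho (g^-1 * y))^-1).
rewrite sdinvE sdmulE; apply/twistedE; split=> //.
by rewrite gactMg gactK mulgA -gactMg mulVg gact1g mul1g.
Qed.

(** Right multiplication by [E] is defined on cosets because [E] commutes with [twisted]; it
    commutes with left translations, hence with their limits. *)
Lemma crel_mulr (R : G) x y w : R x y -> R (x * sd w 1) (y * sd w 1).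
Proof.
have [a [aE bE]] := crel_approx2 R x (x * sd w 1).
move=> /aE [h Lh axy]; apply/bE; exists h => //.
have -> : (a * (x * sd w 1))^-1 * (y * sd w 1) =
  (sd w 1)^-1 * ((a * x)^-1 * y * sd w 1) by group.
by rewrite axy -twist_central// mulKg.
Qed.

(** Right multiplication by [E] is transitive on the elements over [x]. So [R] permutes the fibres
    over the cosets of [L], and the lift [sd 1 x] used in [extproj] is immaterial. *)
Lemma crel_fiber (R : G) u x v y u' : R (sd u x) (sd v y) ->
  exists v', R (sd u' x) (sd v' y).
Proof.
move=> /(@crel_mulr _ _ _ (Del x^-1 (u^-1 * u'))).
by rewrite !sdmulE gactVK mulVKg !mulg1 => R'; eexists; exact: R'.
Qed.

Lemma proj_subproof (R : G) :
  @rel_approx (discrete_data Lsub) (fun x y => exists v, R (sd 1 x) (sd v y)) /\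
  forall y, exists x, exists v, R (sd 1 x) (sd v y).
Proof.
split=> [s|y].
  have [a aE] := crel_approx R (map (sd 1) s); exists (sdr a) => x xs y.
  rewrite -(ceqA_fiber (a * sd 1 x)).
  by split=> -[v Rv]; exists v; apply/aE => //; exact: map_f.
have [[u x] Rx] := crel_exl R (sd 1 y); exists x.
exact: crel_fiber Rx.
Qed.

Definition extproj (R : G) : Q := Completion (proj_subproof R).

Lemma proj_hom : hom extproj.
Proof.
move=> R S _ _; apply: completion_eq => x z /=; split.
  move=> [v [[u y] [Sy Ry]]]; exists y; split; first by exists u.
  exact: crel_fiber Ry.
move=> [y [[u Sy] [v /(crel_fiber u)[v' Ry]]]].
by exists v', (sd u y).
Qed.

Lemma proj_emb (a : A) : extproj (embA a) = embL (sdr a).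
Proof. by apply: completion_eq => x y; exact: (ceqA_fiber (a * sd 1 x)). Qed.

(** Here [intertwined_open] enters: it transfers fixed cosets of [L] to fixed cosets of [twisted],
    so that [Q] controls stabilizers in [G]. *)
Lemma twist_fix (s : seq A) : exists F : seq Gam, forall h, L h ->
  (forall x, x \in F -> L (x^-1 * h * x)) ->
  forall x, x \in s -> ceqA (twist h * x) x.
Proof.
elim: s => [|[v g] s [F FP]]; first by exists [::].
have [F' F'P] := intertwined_open g; exists (F' ++ F) => h Lh hF x.
rewrite inE => /predU1P[->|]; last first.
  by apply: FP => // y yF; apply: hF; rewrite mem_cat yF orbT.
have hg : intertwined g h by apply: F'P => // y yF; apply: hF; rewrite mem_cat yF.
rewrite twist_mul//; apply/ceq_sym/ceq_mulr.
by exists (g^-1 * h * g) => //; case: hg.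
Qed.

Lemma stab_approx (R : G) (s : seq A) : R 1 1 ->
  exists2 h, L h & forall x, x \in s -> forall y, R x y <-> ceqA (twist h * x) y.
Proof.
move=> R1; have [a aE] := crel_approx R (1 :: s).
have : ceqA (a * 1) 1 by apply/aE => //; exact: mem_head.
rewrite mulg1 => /ceq_sym; rewrite /ceq invg1 mul1g => -[h Lh ah].
by exists h => // x xs; rewrite -ah; apply: aE; rewrite inE xs orbT.
Qed.

(** [R] keeps the base coset in its fibre, hence moves it to some [sd v 1]. Dividing by this leaves
    [S], which fixes the base coset and is approximated by twists. *)
Lemma proj_eq1 (R : G) : extproj R = 1 -> exists v, embA (sd v 1) = R.
Proof.
move=> qR; have : (1 : Q) 1 1 by exact: ceqxx.
rewrite -qR => -[v Rv]; exists v.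
suff S1 : (embA (sd v 1) : G)^-1 * R = 1.
  by rewrite -[R](mulVKg (embA (sd v 1) : G)) S1 mulg1.
set S := _ * R; have S11 : S 1 1.
  by exists (sd v 1); split=> //; exact/emb_l1.
have qS : extproj S = 1.
  by rewrite proj_hom// qR mulg1 (homV _ proj_hom) proj_emb (hom1 emb_hom) invg1.
suff Sxx x : S x x by apply: completion_eq => x y; exact: crel_cosetr.
have [F FP] := twist_fix [:: x].
(* Lifts of [F] are included: [S] projects to [1], so [h] fixes the cosets of [F] and [twist_fix]
   applies at [x]. *)
have [h Lh hE] := stab_approx (x :: map (sd 1) F) S11.
apply/hE; first exact: mem_head.
apply: FP; rewrite ?mem_head// => y yF.
have : (1 : Q) y y by exact: ceqxx.
rewrite -qS => -[w /hE]; rewrite inE map_f ?orbT// => /(_ isT) hw.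
have /ceq_sym : ceqL (h * y) y by apply/(ceqA_fiber (twist h * sd 1 y)); exists w.
by rewrite /ceq mulgA.
Qed.

Lemma emb_l_hom : hom (fun v => embA (sd v 1)).
Proof. by move=> v w _ _; rewrite sdlM emb_hom. Qed.

Lemma near1_sd1 : near1 [set sd v 1 | v in setT].
Proof. by apply: near1_image; exact: filterT. Qed.

Lemma proj_continuous : continuous extproj.
Proof.
apply: (continuous_hom proj_hom) => B /nbhs_completion1[U [s [U1 UB]]].
(* All of [E] is allowed as translation part, since it projects to [1]. *)
apply/nbhs_completion1; exists [set sd v 1 | v in setT], (map (sd 1) s).
split; first exact: near1_sd1.
move=> R [_ [v _ <-] Rs]; apply: UB; apply: stab_cball => // x xs.
exists v; have -> : sd v x = sd v 1 * sd 1 x by rewrite sdmulE gact1 mul1g mulg1.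
by apply: Rs; move: xs; rewrite !inE => /predU1P[->|xs]; rewrite ?eqxx// map_f ?orbT.
Qed.

(** The image of the stabilizer is compact, hence closed, so approximating [w] by its elements
    suffices. An approximation [g] of [w] on [1 :: F] lies in [L] and fixes the cosets of [F]; thus
    [twist g] lies in the stabilizer and maps to [embL g]. *)
Lemma proj_stab (s : seq A) : exists F : seq Gam,
  @stab (discrete_data Lsub) F `<=` extproj @` @stab extension_data s.
Proof.
have [F FP] := twist_fix s; exists F => w wF.
have : closed (extproj @` @stab extension_data s).
  apply: compact_closed; first exact: hausdorff_discrete_data.
  apply: continuous_compact; last exact: compact_stab finite_orbits_extension.
  exact/continuous_subspaceT/proj_continuous.
apply=> B /nbhs_discrete_data[t tB].
have [g gE] := crel_approx w (1 :: F ++ t).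
have Lg : L g.
  have : ceqL (g * 1) 1 by apply/gE; [exact: mem_head|apply: wF; exact: mem_head].
  by move=> /ceq_sym; rewrite /ceq invg1 mul1g mulg1.
exists (embL g); split.
  exists (embA (twist g)); last exact: proj_emb.
  have gF : forall x, x \in F -> L (x^-1 * g * x).
    move=> x xF; have : ceqL (g * x) x.
      by apply/gE; [rewrite inE mem_cat xF orbT|apply: wF; rewrite inE xF orbT].
    by move=> /ceq_sym; rewrite /ceq mulgA.
  move=> x; rewrite inE => /predU1P[->|]; last exact: FP.
  change (ceqA (twist g * 1) 1); rewrite mulg1; apply: ceq_sym.
  by rewrite /ceq invg1 mul1g; exists g.
rewrite -(mulVKg w (emb _)); apply: tB => x xt; exists (g * x).
split; first exact: ceqxx.
apply/gE; last exact: ceqxx.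
by move: xt; rewrite !inE mem_cat => /orP[->//|->]; rewrite !orbT.
Qed.

Lemma proj_nbhs1 (B : set G) : nbhs (1 : G) B -> nbhs (1 : Q) (extproj @` B).
Proof.
move=> /nbhs_completion1[U [s [nU UB]]]; have [F FP] := proj_stab s.
apply/nbhs_discrete_data; exists F => w /FP[R sR <-]; rewrite mul1g.
by exists R => //; apply: UB; exact: stab_cball.
Qed.

(** The image contains a neighbourhood of [1] and the dense image of [Gam]. *)
Lemma proj_surj (w : Q) : exists R, extproj R = w.
Proof.
have [F FP] := proj_stab [::]; have [g gE] := crel_approx w (1 :: F).
have [|R _ qR] := FP ((embL g)^-1 * w).
  by move=> x xF; exists (g * x); split; [apply/gE => //|]; exact: ceqxx.
exists (embA (sd 1 g) * R).
by rewrite proj_hom// proj_emb qR mulVKg.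
Qed.

Lemma proj_quotient : topological_quotient_map extproj.
Proof.
split; first exact: proj_surj.
move=> V; split=> [oV|/(open_hom proj_hom proj_nbhs1)].
  by apply: open_comp => // x _; exact: proj_continuous.
suff -> : extproj @` (extproj @^-1` V) = V by [].
apply/seteqP; split=> [_ [R VR <-]//|w Vw].
by have [R qR] := proj_surj w; exists R; rewrite //= qR.
Qed.

Lemma emb_l_embedding :
  topological_embedding (fun v => embA (sd v 1)).
Proof.
split; [|split].
- by move=> v w vw; apply/emb_l1; rewrite vw; exact/emb_l1.
- apply: (continuous_hom emb_l_hom) => B /nbhs_completion1[U [s [nU UB]]].
  have {}nU : nbhs (1 : E) [set v | U (sd v 1)] := nU.
  apply: filterS nU => v Uv; apply: UB; exists (sd v 1) => // x _.
  exact: ceqxx.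
(* The elements sending the base coset into [U]; by [emb_l1] this set meets [E] in [U]. *)
move=> U oU; exists [set R : G | exists2 u, U u & R 1 (sd u 1)]; split.
  rewrite openE => R [u Uu Ru].
  have /nbhs_translate nU : nbhs u U by exact: open_nbhs_nbhs.
  exists [set sd v 1 | v in [set v | U (u * v)]], [::]; split; first exact: near1_image.
  move=> T [_ [v Uv <-] Tv]; exists (u * v) => //.
  exists (sd v 1); split; first by rewrite -[sd v 1]mulg1; apply: Tv; exact: mem_head.
  by rewrite sdlM -{1}[sd v 1]mul1g; exact: crel_mulr.
apply/seteqP; split=> [v Uv|v [u Uu /emb_l1 ->]//].
by exists v => //; exact/emb_l1.
Qed.

(** [twisted] meets [E] trivially, so a coset has at most one representative in [E]; if it has one
    in every neighbourhood of [1], that one is [1]. *)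
Lemma hausdorff_extension : hausdorff_space E -> hausdorff_space G.
Proof.
move=> hE; apply: hausdorff_completion.
  exists [set sd v 1 | v in setT]; first exact: near1_sd1.
  by move=> _ [v _ <-] /twistedE[_ ->]; rewrite rho1 invg1.
move=> a aU; have [_ [v _ <-] av] := aU _ near1_sd1.
suff v1 : v = 1 by move: av; rewrite v1 => /ceq_sym; rewrite /ceq invg1 mul1g.
symmetry; apply: hE => B C B1 /nbhs_singleton Cv.
have [_ [w Bw <-] aw] := aU _ (near1_image B1).
by exists v; split=> //; rewrite (ceqA_l (ceq_trans (ceq_sym av) aw)).
Qed.

Definition box (K : set E) : set G := [set R | exists a b,
  [set embA (sd v 1) | v in K] a /\ stab [::] b /\ R = a * b].

Lemma compact_box (K : set E) : compact K -> compact (box K).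
Proof.
move=> cK; apply: compact_mulg; last exact: compact_stab finite_orbits_extension.
apply: continuous_compact => //; apply: continuous_subspaceT.
by case: emb_l_embedding => _ [].
Qed.

Lemma locally_compact_extension : locally_compact_group E -> locally_compact_group G.
Proof.
move=> [hE lcE]; have [K K1 [cK _]] := lcE 1 I.
apply: (@locally_compact_group_nbhs1 _ (box K)); first exact: hausdorff_extension.
  exact: compact_box.
apply/nbhs_completion1; exists [set sd v 1 | v in K], [::]; split.
  by apply: near1_image; move: K1; rewrite withinET.
move=> R /cball_emb[_ [v Kv <-] [S S1 ->]].
by exists (embA (sd v 1)), S; split=> //; exists v.
Qed.

(** * Discreteness and cocompactness of the image of [Gam] *)

Definition ballA (U : set E) : set G :=
  @cball extension_data [set sd v 1 | v in U] [::].

Definition extlift (g : Gam) : G := embA (sd 1 g).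

Lemma lift_hom : hom extlift.
Proof. by move=> g h _ _; rewrite /extlift -emb_hom// sdmulE gact1g mulg1. Qed.

(** For [g] in [L], [sd 1 g = sd (rho g) 1 * twist g], so the coset of [sd 1 g] is that of
    [sd (rho g) 1]. *)
Lemma lift_box (U : set E) g :
  ballA U (extlift g) -> L g /\ U (rho g).
Proof.
move=> [_ [v Uv <-] /(_ 1 (mem_head _ _))] /=; rewrite /ceq /= !mulg1 sdinvE sdmulE mulg1.
move=> /twistedE[/LV]; rewrite invgK => Lg; rewrite rhoV// invgK invg1 gact1g mul1g => vg.
suff <- : v = rho g by [].
by rewrite -(gactVK Del g v) vg DelL//; group.
Qed.

(** [R] sends some [sd 1 g] to [sd e 1] with [e = k * rho h]. Replacing [g] by [g * h^-1] turns [e]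
    into [k], because [sd 1 h^-1] is [sd (rho h^-1) 1] up to a twist. *)
Lemma lift_orbit (R : G) (K : set E) :
  (forall e, exists k h, K k /\ L h /\ e = k * rho h) ->
  exists k g, K k /\ R (sd 1 g) (sd k 1).
Proof.
move=> KL; have [[v g] Rv] := crel_exl R (sd 1 1).
have [e Re] := crel_fiber 1 Rv.
have [k [h [Kk [Lh eE]]]] := KL e.
exists k, (g * h^-1); split=> //.
have Lh' := LV Lh.
have Rt : R (sd 1 g * twist h^-1) (sd e 1).
  by apply/(crel_cosetl _ Re)/ceq_mulr; exists h^-1.
have := crel_mulr (rho h^-1) Rt; rewrite -sdlM {2}rhoV// eE mulgK.
rewrite -mulgA -twist_central// /twist sdmulE gact1 mulgV mul1g.
by rewrite sdmulE gact1g mulg1.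
Qed.

Lemma lift_lattice : locally_compact_group E ->
  finite_set [set h | L h /\ rho h = 1] ->
  (exists2 U, nbhs (1 : E) U & forall h, L h -> U (rho h) -> rho h = 1) ->
  (exists2 K, compact K & forall e, exists k h, K k /\ L h /\ e = k * rho h) ->
  virtual_uniform_lattice_embedding extlift.
Proof.
move=> lcE fin [U U1 Urho] [K cK KL].
have hG : hausdorff_space G by apply: hausdorff_extension; case: lcE.
have sub : is_subgroup (extlift @` [set: Gam]).
  by apply: subgroup_image => //; exact: lift_hom.
have UG : nbhs (1 : G) (ballA U).
  by apply/nbhs_completion1; exists [set sd v 1 | v in U], [::]; split=> //; exact: near1_image.
split; [exact: lift_hom|split; [|split=> //; split]].
- apply: sub_finite_set fin => g [_ g1].
  have /lift_box[Lg Ug] : ballA U (extlift g).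
    by rewrite g1; exact: nbhs_singleton UG.
  by split=> //; exact: Urho.
(* [ballA U] meets the image of [Gam] only in the finite image of the kernel of [rho] on [L];
   removing the nontrivial elements [Z] isolates [1]. *)
- pose Z := (extlift @` [set h | L h /\ rho h = 1]) `\ 1.
  have cZ : closed Z.
    apply: compact_closed => //; apply: finite_compact.
    by apply: finite_setD; exact: finite_image.
  apply: (discrete_subgroup sub (A := ballA U `&` ~` Z)).
    apply: filterI => //; apply: open_nbhs_nbhs; split; first exact: closed_openC.
    by case=> _ /(_ erefl).
  move=> _ [] /[swap] -[g _ <-] [/lift_box[Lg Ug] nZ]; apply: contrapT => g1; apply: nZ; split=> //.
  by exists g => //; split=> //; exact: Urho.
- exists (box K); split; first exact: compact_box.
  move=> R; have [k [g [Kk Rk]]] := lift_orbit R KL.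
  pose a : G := embA (sd k 1).
  (* [a^-1 * R * extlift g] fixes the base coset: [1] goes to [sd 1 g], then to [sd k 1], then back
     to [1]. *)
  exists (a * (a^-1 * R * extlift g)), (extlift g^-1); split; [|split].
  + exists a, (a^-1 * R * extlift g); split; first by exists k.
    split=> // x; rewrite inE => /eqP ->.
    exists (sd 1 g); split.
      by change (ceqA (sd 1 g * 1) (sd 1 g)); rewrite mulg1; exact: ceqxx.
    by exists (sd k 1); split=> //; exact/emb_l1.
  + by exists g^-1.
  + by rewrite (homV _ lift_hom); group.
Qed.

End Extension.

(** * The choice of the finite index subgroup *)

Lemma subgroupI (G : groupType) (H K : set G) :
  is_subgroup H -> is_subgroup K -> is_subgroup (H `&` K).
Proof.
move=> [H1 [HM HV]] [K1 [KM KV]]; split=> //; split.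
  by move=> x y [Hx Kx] [Hy Ky]; split; [exact: HM|exact: KM].
by move=> x [Hx Kx]; split; [exact: HV|exact: KV].
Qed.

(** The [g] admitting such an [F] form a subgroup containing [S]. For a product [a * b], the
    relation for [b] is used at [a^-1 * h * a], which explains the translated list
    [map (mul a) F']. *)
Lemma intertwined_generated (Gam : groupType) (E : topGroupType)
    (Del : group_action Gam E) (L : set Gam) (rho : Gam -> E) (S : seq Gam) :
  (forall H : set Gam, is_subgroup H -> (forall x, x \in S -> H x) -> H = setT) ->
  (forall g, g \in S -> forall h, L h -> Del g^-1 (rho h) = rho (g^-1 * h * g)) ->
  is_subgroup L -> hom_on L rho ->
  forall g, exists F : seq Gam, forall h, L h ->
    (forall x, x \in F -> L (x^-1 * h * x)) -> intertwined Del L rho g h.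
Proof.
move=> Sgen Sint [L1 [LM LV]] rhoM g.
pose P : set Gam := [set g | exists F : seq Gam, forall h, L h ->
  (forall x, x \in F -> L (x^-1 * h * x)) -> intertwined Del L rho g h].
suff : P = setT by move=> PT; have : setT g by []; rewrite -PT.
apply: Sgen; last first.
  move=> s sS; exists [:: s] => h Lh hF; split; last exact: Sint.
  by apply: hF; exact: mem_head.
split; [|split].
- by exists [::] => h Lh _; split; rewrite ?invg1 ?gact1 mul1g mulg1.
- move=> a b [F FP] [F' F'P]; exists (F ++ map (mul a) F') => h Lh hF.
  have [La rhoa] : intertwined Del L rho a h.
    by apply: FP => // x xF; apply: hF; rewrite mem_cat xF.
  have [Lb rhob] : intertwined Del L rho b (a^-1 * h * a).
    apply: F'P => // x xF.
    have := hF (a * x); rewrite mem_cat map_f ?orbT// => /(_ isT).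
    by group.
  split; first by move: Lb; group.
  rewrite invgM gact_mul rhoa rhob; congr rho; group.
- move=> a [F FP]; exists (a^-1 :: map (mul a^-1) F) => h Lh hF.
  have La : L (a * h * a^-1) by have := hF _ (mem_head _ _); rewrite invgK.
  (* The relation for [a] at [a * h * a^-1], read backwards, is the relation for [a^-1] at [h]. *)
  have [_] : intertwined Del L rho a (a * h * a^-1).
    apply: FP => // x xF.
    have := hF (a^-1 * x); rewrite inE map_f ?orbT// => /(_ isT).
    by group.
  have -> : a^-1 * (a * h * a^-1) * a = h by group.
  by rewrite /intertwined invgK => <-; rewrite gactVK.
Qed.

Section EngulfingTriple.
Variables (Gam : groupType) (Lam : set Gam) (E : topGroupType) (rho : Gam -> E).
Variable Del : group_action Gam E.
Hypothesis Lam_sub : is_subgroup Lam.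
Hypothesis Del_rho : forall g, exists Lg : set Gam,
  is_subgroup Lg /\ finite_index Lg Lam /\ (forall h, Lg h -> Lam (g * h * g^-1)) /\
  forall h, Lg h -> Del g (rho h) = rho (g * h * g^-1).

Lemma intertwining_subgroup (s : seq Gam) : exists L : set Gam,
  is_subgroup L /\ finite_index L Lam /\
  forall g, g \in s -> forall h, L h -> Del g^-1 (rho h) = rho (g^-1 * h * g).
Proof.
elim: s => [|g s [L [Lsub [LLam Lrho]]]].
  exists Lam; split=> //; split=> //; split=> //; exists [:: 1]; split=> [x|k Lk].
    by rewrite inE => /eqP ->; case: Lam_sub.
  by exists 1; rewrite ?mem_head ?invg1 ?mul1g.
have [Lg [Lgsub [LgLam [_ Lgrho]]]] := Del_rho g^-1.
exists (L `&` Lg); split; first exact: subgroupI.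
split.
  apply: (finite_index_trans Lam_sub _ LLam).
  by apply: (finite_indexI Lsub Lgsub _ LgLam); case: LLam.
move=> x; rewrite inE => /predU1P[->|xs] h [Lh Lgh]; last exact: Lrho.
by rewrite Lgrho// invgK.
Qed.

Lemma intertwined_finite_index (L : set Gam) g : is_subgroup L -> finite_index L Lam ->
  exists2 M, finite_index M L & forall h, M h -> intertwined Del L rho g h.
Proof.
move=> Lsub LLam; have [Lg [Lgsub [LgLam [Lggam Lgrho]]]] := Del_rho g^-1.
have conjM : hom_on Lg (fun h => g^-1 * h * g) by move=> x y _ _; group.
pose M := [set h | Lg h /\ L (g^-1 * h * g)].
have MLam : finite_index M Lam.
  apply: (finite_index_trans Lam_sub _ LgLam).
  apply: (finite_index_preim Lgsub Lsub conjM _ LLam) => x /Lggam.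
  by rewrite invgK.
exists (L `&` M).
  apply: (finite_indexI Lsub _ _ MLam); last by case: LLam.
  exact: (subgroup_preim Lgsub Lsub conjM).
by move=> h [_ [Lgh Lh]]; split=> //; rewrite Lgrho// invgK.
Qed.

(** The images of finitely many coset representatives of [L] in [Lam] are absorbed into the compact
    set. *)
Lemma lattice_finite_index (L : set Gam) (K : set E) :
  hom_on Lam rho -> finite_index L Lam -> compact K ->
  (forall e, exists k h, K k /\ Lam h /\ e = k * rho h) ->
  exists2 K', compact K' & forall e, exists k h, K' k /\ L h /\ e = k * rho h.
Proof.
move=> rhoM [LLam [s [sLam sP]]] cK KP.
exists [set x | exists a b, K a /\ [set rho x | x in [set` s]] b /\ x = a * b].
  apply: compact_mulg => //; apply: finite_compact; apply: finite_image.
  exact: finite_seq.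
move=> e; have [k [h [Kk [Lh ->]]]] := KP e; have [x xs Lxh] := sP _ Lh.
exists (k * rho x), (x^-1 * h); split; first by exists k, (rho x); split=> //; split=> //; exists x.
split=> //; rewrite -mulgA -rhoM ?mulVKg//; first exact: sLam.
exact: LLam.
Qed.

End EngulfingTriple.

Lemma top_group_aut1 (Gam : groupType) (E : topGroupType) (Delta : Gam -> E -> E) :
  (forall g, top_group_aut (Delta g)) ->
  (forall g h v, Delta (g * h) v = Delta g (Delta h v)) -> forall v, Delta 1 v = v.
Proof.
move=> Daut DM v; have [_ [_ [b [bK _]]]] := Daut 1.
by apply: (can_inj bK); rewrite -DM mulg1.
Qed.

Theorem theorem5p2 (Gam : groupType) (Lam : set Gam) (E : topGroupType)
    (rho : Gam -> E) (Delta : Gam -> E -> E) :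
  finitely_generated Gam ->
  hecke_pair Lam ->
  engulfing_triple Lam rho Delta ->
  exists (G : topGroupType) (gam : Gam -> G) (Q : topGroupType)
         (lam : Gam -> Q) (p : E -> G) (q : G -> Q),
    locally_compact_group G /\
        virtual_uniform_lattice_embedding gam /\
        (* short exact sequence 1 -> E -p-> G -q-> Q -> 1 *)
        (hom p /\ hom q /\ injective p /\ (forall y, exists x, q x = y) /\
         forall x, q x = 1 <-> exists v, p v = x) /\
        (* (1) *)
        (exists L0 : set Gam, is_subgroup L0 /\ finite_index L0 Lam /\
           schlichting_completion L0 lam) /\
        (* (2) *)
        (topological_embedding p /\ topological_quotient_map q) /\
        (* (3) *)
        (forall g, lam g = q (gam g)) /\
        (* (4) *)
        (forall g v, p (Delta g v) = gam g * p v * (gam g)^-1).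
Proof.
move=> [S Sgen] [Lsub _] [lcE [rhoM [fin [rhosub [rhodisc [K [cK KP]]]]]] [Daut DM] DL Drho].
pose Del := GroupAction (fun g => (Daut g).1) DM (top_group_aut1 Daut DM).
(* The relation is imposed on [L] for the generators only; [intertwined_generated] then handles
   every [g]. *)
have [L [L0sub [LLam LS]]] := intertwining_subgroup (Del := Del) Lsub Drho S.
have Lsubset : L `<=` Lam by case: LLam.
have rhoML : hom_on L rho by move=> x y /Lsubset Lx /Lsubset Ly; exact: rhoM.
have Dcont g : continuous (Del g) by case: (Daut g) => _ [].
have DelL h : L h -> forall e, Del h e = rho h * e * (rho h)^-1.
  by move=> /Lsubset; exact: DL.
have index g := intertwined_finite_index (Del := Del) Lsub Drho g L0sub LLam.
have opn := intertwined_generated Sgen LS L0sub rhoML.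
have KP' e : exists k h, K k /\ Lam h /\ e = k * rho h.
  by have [k [_ [Kk [[h Lh <-] ->]]]] := KP e; exists k, h.
have [K' cK' K'P] := lattice_finite_index rhoM LLam cK KP'.
(* [U] isolates [1] in the image of [Lam], so [rho h] in [U] with [h] in [L] forces [rho h = 1]. *)
have [U [oU U1 UE]] := rhodisc 1 (rhosub.1).
exists (completion (extension_data L0sub rhoML Dcont DelL)),
  (@extlift _ _ _ _ _ L0sub rhoML Dcont DelL),
  (completion (discrete_data L0sub)), (@emb (discrete_data L0sub)),
  (fun v => @emb (extension_data L0sub rhoML Dcont DelL) (Sd v 1)),
  (@extproj _ _ _ _ _ L0sub rhoML Dcont DelL).
split; first exact: locally_compact_extension.
split.
  apply: lift_lattice => //.
  - by apply: sub_finite_set fin => h [/Lsubset].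
  - exists U; first exact: open_nbhs_nbhs.
    move=> h Lh Uh; have : (U `&` (rho @` Lam)) (rho h).
      by split=> //; exists h => //; exact: Lsubset.
    by rewrite UE.
  - by exists K'.
split.
  split; first exact: emb_l_hom.
  split; first exact: proj_hom.
  split; first by case: (emb_l_embedding L0sub rhoML Dcont DelL).
  split; first exact: proj_surj.
  move=> x; split=> [|[v <-]]; first exact: proj_eq1.
  by rewrite proj_emb /= (hom1 emb_hom).
split; first by exists L; split=> //; split=> //; exact: schlichting_completion_discrete.
split; first by split; [exact: emb_l_embedding|exact: proj_quotient].
split; first by move=> g; rewrite proj_emb.
move=> g v; rewrite /extlift -(homV _ emb_hom) -!emb_hom//.
by rewrite sdlJ mul1g invg1 mulg1.
Qed.
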